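(* Let $$Z(s)=\frac{a_3s^3+a_2s^2+a_1s+a_0}{d_3s^3+d_2s^2+d_1s+d_0}$$ with $a_i,d_j>0$ for $i,j=0,1,2,3$, McMillan degree $\delta(Z(s))=3$, and no pole or zero on $j\mathbb{R}\cup\infty$. Then $Z(s)$ is realizable as a five-element non-series-parallel network if and only if $Z(s)$ is realizable as one of the following 11 bridge configurations: $\mathcal{N}_{7a}=\mathrm{Br}(c_1,k_1,c_2,b_1;k_2)$, $\mathcal{N}_{7b}=\mathrm{Br}(c_1,c_2,b_1,k_1;b_2)$, $\mathcal{N}_{7c}=\mathrm{Br}(c_1,b_1,c_2,k_1;b_2)$, $\mathcal{N}_{7d}=\mathrm{Br}(c_1,c_2,k_1,b_1;k_2)$; $\mathcal{N}_{8a}=\mathrm{Br}(k_1,c_2,c_1,b_1;k_2)$, $\mathcal{N}_{8b}=\mathrm{Br}(b_1,c_1,c_2,k_1;b_2)$; $\mathcal{N}_{9a}=\mathrm{Br}(c_1,k_2,k_1,c_2;b_1)$, $\mathcal{N}_{9b}=\mathrm{Br}(c_1,b_1,b_2,c_2;k_1)$; $\mathcal{N}_{10a}=\mathrm{Br}(c_1,k_2,k_1,b_1;c_2)$, $\mathcal{N}_{10b}=\mathrm{Br}(c_1,b_1,b_2,k_1;c_2)$; $\mathcal{N}_{11}=\mathrm{Br}(k_1,b_2,b_1,k_2;c_1)$.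
   Context: Networks are two-terminal linear time-invariant networks consisting of dampers, springs and inerters with positive finite element values: a finite connected graph (multiple edges allowed) with two distinguished vertices $a,a'$ (the terminals), each edge being one element and, as usual, lying on some simple path from $a$ to $a'$. The impedance of a network is its driving-point impedance (velocity plays the role of voltage, force the role of current); a damper $c>0$ has impedance $1/c$, a spring $k>0$ has impedance $s/k$, an inerter $b>0$ has impedance $1/(bs)$. A network is series-parallel if it is a single element or a series or parallel connection of two smaller series-parallel networks, and non-series-parallel otherwise. $\mathrm{Br}(A,B,C,D;E)$ denotes the bridge network with terminals $a,a'$ and two internal vertices $1,2$, where element $A$ joins $a$ and $1$, $B$ joins $a$ and $2$, $C$ joins $1$ and $a'$, $D$ joins $2$ and $a'$, and $E$ joins $1$ and $2$. With the same letters denoting the element impedances, its impedance is $\dfrac{E(A+C)(B+D)+AB(C+D)+CD(A+B)}{E(A+B+C+D)+(A+B)(C+D)}$. Here $c_i,k_i,b_i$ denote dampers, springs and inerters. $Z(s)$ is realizable as a configuration if there are positive finite element values for which the impedance of the configuration equals $Z(s)$. For $Z=a/d$ with coprime polynomials $a,d$, the McMillan degree is $\delta(Z)=\max\{\deg a,\deg d\}$. *)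

(* Defs.v *)
From mathcomp Require Import all_boot all_order all_algebra.
From mathcomp Require Import reals.
From mathcomp.real_closed Require Import complex.

Set Implicit Arguments.
Unset Strict Implicit.
Unset Printing Implicit Defensive.

Import GRing.Theory Num.Theory.
Local Open Scope ring_scope.

(** Rational functions of the Laplace variable s = 'X with real coefficients.
    All impedances live in this field, so equality of impedances is equality
    of rational functions. *)
Notation ratfun R := {fraction {poly R}}.

Definition to_ratfun (R : realType) (p : {poly R}) : ratfun R :=
  @FracField.tofrac _ p.

Definition coprime_repr (R : realType) (Z : ratfun R) (p q : {poly R}) : Prop :=
  [/\ q != 0, coprimep p q & Z = to_ratfun p / to_ratfun q].

(** [coprime_repr Z p q] determines (p, q) up to a common nonzero constant, so
    the notions below do not depend on the representation. Recall that
    [size p] is deg p + 1 for p != 0. *)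
Definition mcmillan_degree (R : realType) (Z : ratfun R) (n : nat) : Prop :=
  exists p q, coprime_repr Z p q /\ maxn (size p).-1 (size q).-1 = n.

Definition zero_at (R : realType) (Z : ratfun R) (z : R[i]) : Prop :=
  exists p q, coprime_repr Z p q /\ root (map_poly (real_complex R) p) z.

Definition pole_at (R : realType) (Z : ratfun R) (z : R[i]) : Prop :=
  exists p q, coprime_repr Z p q /\ root (map_poly (real_complex R) q) z.

Definition zero_at_infty (R : realType) (Z : ratfun R) : Prop :=
  exists p q, coprime_repr Z p q /\ (size p < size q)%N.

Definition pole_at_infty (R : realType) (Z : ratfun R) : Prop :=
  exists p q, coprime_repr Z p q /\ (size q < size p)%N.

(** No pole or zero on jR together with the point at infinity. *)
Definition no_pole_zero_imaginary (R : realType) (Z : ratfun R) : Prop :=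
  [/\ forall w : R, ~ zero_at Z (Complex 0 w) /\ ~ pole_at Z (Complex 0 w),
      ~ zero_at_infty Z & ~ pole_at_infty Z].

Inductive element_kind := damper | spring | inerter.

Definition element_impedance (R : realType) (k : element_kind) (x : R) :
    ratfun R :=
  match k with
  | damper => 1 / to_ratfun x%:P
  | spring => to_ratfun 'X / to_ratfun x%:P
  | inerter => 1 / to_ratfun (x *: 'X)
  end.

(** A two-terminal multigraph with the kind, but not the value, of the element
    on each edge. The orientation [src -> tgt] of an edge is only a reference
    direction for its through-variable. *)
Record configuration := Configuration {
  vertex : finType;
  branch : finType;
  src : branch -> vertex;
  tgt : branch -> vertex;
  kind : branch -> element_kind;
  terminal : vertex;
  terminal' : vertex
}.

Definition joins (N : configuration) (e : branch N) (x y : vertex N) : bool :=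
  ((src e == x) && (tgt e == y)) || ((src e == y) && (tgt e == x)).

Definition adjacent (N : configuration) : rel (vertex N) :=
  fun x y => [exists e, joins e x y].
Arguments adjacent : clear implicits.

(** The simple path runs a :: p1 ++ y :: p2, and e is one of the edges between
    its consecutive vertices [last a p1] and [y]. *)
Definition on_simple_path (N : configuration) (e : branch N) : Prop :=
  exists (p1 p2 : seq (vertex N)) (y : vertex N),
    let p := p1 ++ y :: p2 in
    [/\ path (adjacent N) (terminal N) p,
        last (terminal N) p = terminal' N,
        uniq (terminal N :: p)
      & joins e (last (terminal N) p1) y].

Definition is_network (N : configuration) : Prop :=
  [/\ terminal N != terminal' N,
      forall x y : vertex N, connect (adjacent N) x y
    & forall e : branch N, on_simple_path e].

Definition ends (N : configuration) (A : {set branch N}) : {set vertex N} :=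
  [set src e | e in A] :|: [set tgt e | e in A].

(** [sp_between A x y]: the edges in A form a series-parallel network with
    terminals x and y. The parts of a series (resp. parallel) connection meet
    exactly in the middle vertex (resp. in both terminals). *)
Inductive sp_between (N : configuration) :
    {set branch N} -> vertex N -> vertex N -> Prop :=
| SpSingle e x y : x != y -> joins e x y -> sp_between [set e] x y
| SpSeries A B x y z :
    sp_between A x y -> sp_between B y z ->
    [disjoint A & B] -> ends A :&: ends B = [set y] ->
    sp_between (A :|: B) x z
| SpParallel A B x y :
    sp_between A x y -> sp_between B x y ->
    [disjoint A & B] -> ends A :&: ends B = [set x; y] ->
    sp_between (A :|: B) x y.

Definition series_parallel (N : configuration) : Prop :=
  sp_between [set: branch N] (terminal N) (terminal' N).

(** Driving-point impedance: a unit force (current) is driven into [terminal]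
    and out of [terminal'], and Z is the resulting relative velocity (voltage)
    between the terminals. The three conditions are the law of each element,
    the balance of through-variables at each vertex, and the port reading. For
    a connected network with positive element values the solution v is unique
    up to an additive constant, so Z is determined. *)
Definition has_impedance (R : realType) (N : configuration)
    (x : branch N -> R) (Z : ratfun R) : Prop :=
  exists (v : vertex N -> ratfun R) (f : branch N -> ratfun R),
    [/\ forall e, v (src e) - v (tgt e) = element_impedance (kind e) (x e) * f e,
        forall u, \sum_(e | src e == u) f e - \sum_(e | tgt e == u) f e
                  = (u == terminal N)%:R - (u == terminal' N)%:R
      & v (terminal N) - v (terminal' N) = Z].

Definition realizable (R : realType) (N : configuration) (Z : ratfun R) : Prop :=
  exists x : branch N -> R, (forall e, 0 < x e) /\ has_impedance x Z.

(** Vertices of [bridge]: 0 and 3 are the terminals a and a', 1 and 2 are the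
    internal vertices. Branches 0, ..., 4 carry A, B, C, D, E. *)
Definition bridge_src : 5.-tuple 'I_4 :=
  [tuple @Ordinal 4 0 isT; @Ordinal 4 0 isT; @Ordinal 4 1 isT;
         @Ordinal 4 2 isT; @Ordinal 4 1 isT].

Definition bridge_tgt : 5.-tuple 'I_4 :=
  [tuple @Ordinal 4 1 isT; @Ordinal 4 2 isT; @Ordinal 4 3 isT;
         @Ordinal 4 3 isT; @Ordinal 4 2 isT].

Definition bridge (A B C D E : element_kind) : configuration :=
  @Configuration 'I_4 'I_5
    (tnth bridge_src) (tnth bridge_tgt) (tnth [tuple A; B; C; D; E])
    (@Ordinal 4 0 isT) (@Ordinal 4 3 isT).

(** Elements of the same kind (c1 and c2, say) have independent values, hence
    a bridge configuration is given by the kinds of its five elements. *)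
Definition N7a := bridge damper spring damper inerter spring.
Definition N7b := bridge damper damper inerter spring inerter.
Definition N7c := bridge damper inerter damper spring inerter.
Definition N7d := bridge damper damper spring inerter spring.
Definition N8a := bridge spring damper damper inerter spring.
Definition N8b := bridge inerter damper damper spring inerter.
Definition N9a := bridge damper spring spring damper inerter.
Definition N9b := bridge damper inerter inerter damper spring.
Definition N10a := bridge damper spring spring inerter damper.
Definition N10b := bridge damper inerter inerter spring damper.
Definition N11 := bridge spring inerter inerter spring damper.

(* Main.v *)
Require Import Defs.
From mathcomp Require Import all_boot all_order all_algebra.
From mathcomp Require Import reals.
From mathcomp Require Import ring lra zify.

(** A network without parallel branches and without internal vertices of degree
    two has degree at least three at each internal vertex, so with at most five
    branches it is a single branch or the bridge; merging parallel and series
    pairs reduces every other network to fewer than five branches, where it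
    becomes series-parallel.

    Multiplying element impedances by s turns them into monomials. If a/d is the
    reduced cubic fraction and p/q the bridge formula, a q = d p forces the
    lowest and the highest exponents of p and q to agree and to differ by at
    least three. Up to the symmetries of the bridge only thirteen labelings
    satisfy this: the eleven listed ones and two with a single damper, in an arm.
    For these two p/q has degree four, hence p and q have a common nonzero real
    root, which is impossible because, viewed as affine functions of one arm,
    their resultant is a perfect square. *)

Set Implicit Arguments.
Unset Strict Implicit.
Unset Printing Implicit Defensive.

Import Order.TTheory GRing.Theory Num.Theory.
Local Open Scope ring_scope.

(** * Impedances *)

(** A single sum over all branches can be reindexed along a bijection of branches, and expanded into
    five terms for the bridge. *)
Lemma net_flowE (K : pzRingType) (N : configuration) (f : branch N -> K)
    (u : vertex N) :
  \sum_(e | src e == u) f e - \sum_(e | tgt e == u) f e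
    = \sum_e ((src e == u)%:R - (tgt e == u)%:R) * f e.
Proof.
rewrite [in LHS]big_mkcond [X in _ - X]big_mkcond /= -sumrB.
by apply: eq_bigr => e _; rewrite mulrBl; do 2!case: eqP; rewrite !(mul1r, mul0r).
Qed.

Lemma has_impedance_transport (R : realType) (N N' : configuration)
    (phi : vertex N' -> vertex N) (psi : branch N' -> branch N)
    (x : branch N -> R) (Z : ratfun R) :
    injective phi -> bijective psi ->
    phi (terminal N') = terminal N -> phi (terminal' N') = terminal' N ->
    (forall e, kind (psi e) = kind e) ->
    (forall e, joins (psi e) (phi (src e)) (phi (tgt e))) ->
  has_impedance x Z -> has_impedance (x \o psi) Z.
Proof.
move=> phiI psiB phi_a phi_a' psi_kind psi_joins [v [f [law bal port]]].
(* The isomorphism may reverse the reference direction of a branch. There the flow changes sign,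
   which keeps both the element law and the vertex balance. *)
pose sg e : ratfun R := if src (psi e) == phi (src e) then 1 else -1.
exists (v \o phi), (fun e => sg e * f (psi e)); split.
- move=> e /=; have := law (psi e); rewrite /sg psi_kind.
  case: eqP => [src_e | /eqP src_e].
    case/orP: (psi_joins e) => /andP[/eqP se /eqP te]; first by rewrite se te mul1r.
    by rewrite src_e te -se src_e mul1r.
  case/orP: (psi_joins e) => /andP[/eqP se /eqP te]; first by rewrite se eqxx in src_e.
  by rewrite se te mulN1r mulrN => <-; rewrite opprB.
- move=> u; have := bal (phi u); rewrite -phi_a -phi_a' !(inj_eq phiI) => <-.
  rewrite !net_flowE (reindex psi) /=; last exact: onW_bij.
  apply: eq_bigr => e _; rewrite /sg -![_ == u](inj_eq phiI) mulrCA.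
  case: (src (psi e) =P _) => [src_e | /eqP src_e].
    case/orP: (psi_joins e) => /andP[/eqP se /eqP te]; first by rewrite se te mul1r.
    by rewrite src_e te -se src_e mul1r.
  case/orP: (psi_joins e) => /andP[/eqP se /eqP te]; first by rewrite se eqxx in src_e.
  by rewrite se te; ring.
- by rewrite /= phi_a phi_a'.
Qed.

Lemma realizable_transport (R : realType) (N N' : configuration)
    (phi : vertex N' -> vertex N) (psi : branch N' -> branch N) (Z : ratfun R) :
    injective phi -> bijective psi ->
    phi (terminal N') = terminal N -> phi (terminal' N') = terminal' N ->
    (forall e, kind (psi e) = kind e) ->
    (forall e, joins (psi e) (phi (src e)) (phi (tgt e))) ->
  realizable N Z -> realizable N' Z.
Proof.
move=> phiI psiB pa pa' psi_kind psi_joins [x [x_gt0 xZ]].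
exists (x \o psi); split=> [e|]; first exact: x_gt0.
exact: has_impedance_transport pa pa' psi_kind psi_joins xZ.
Qed.

Definition reversed (N : configuration) : configuration :=
  Configuration (@src N) (@tgt N) (@kind N) (terminal' N) (terminal N).

(** Negating all potentials and all flows turns a solution for one port direction into a solution
    for the other. *)
Lemma realizable_reversed (R : realType) (N : configuration) (Z : ratfun R) :
  realizable N Z -> realizable (reversed N) Z.
Proof.
move=> [x [x_gt0 [v [f [law bal port]]]]]; exists x; split=> //.
exists (fun u => - v u), (fun e => - f e); split=> [e|u|] /=.
- by rewrite mulrN -law opprB addrC opprK.
- by rewrite !sumrN opprK addrC -[RHS]opprB -bal opprB.
- by rewrite -port opprK addrC.
Qed.

Section Bridge.
Variable R : realType.
Implicit Types (A B C D E : element_kind) (Z : ratfun R).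

(** The isomorphism exchanges the two internal vertices, so it swaps A with B and C with D and
    traverses E backwards. *)
Lemma bridge_mirror A B C D E Z :
  realizable (bridge A B C D E) Z -> realizable (bridge B A D C E) Z.
Proof.
pose t := [tuple @Ordinal 4 0 isT; @Ordinal 4 2 isT; @Ordinal 4 1 isT; @Ordinal 4 3 isT].
pose r := [tuple @Ordinal 5 1 isT; @Ordinal 5 0 isT; @Ordinal 5 3 isT;
                 @Ordinal 5 2 isT; @Ordinal 5 4 isT].
apply: (@realizable_transport R (bridge A B C D E) (bridge B A D C E)
  (tnth t) (tnth r)) => //.
- by apply: can_inj (tnth t) _ => -[[|[|[|[|]]]] i] //; apply: val_inj.
- by exists (tnth r) => -[[|[|[|[|[|]]]]] i] //; apply: val_inj.
- by case=> [[|[|[|[|[|]]]]] i].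
- by case=> [[|[|[|[|[|]]]]] i].
Qed.

(** Exchanging the terminals while fixing the internal vertices swaps A with C and B with D. *)
Lemma bridge_reversed A B C D E Z :
  realizable (bridge A B C D E) Z -> realizable (bridge C D A B E) Z.
Proof.
pose t := [tuple @Ordinal 4 3 isT; @Ordinal 4 1 isT; @Ordinal 4 2 isT; @Ordinal 4 0 isT].
pose r := [tuple @Ordinal 5 2 isT; @Ordinal 5 3 isT; @Ordinal 5 0 isT;
                 @Ordinal 5 1 isT; @Ordinal 5 4 isT].
move/realizable_reversed.
apply: (@realizable_transport R (reversed (bridge A B C D E)) (bridge C D A B E)
  (tnth t) (tnth r)) => //.
- by apply: can_inj (tnth t) _ => -[[|[|[|[|]]]] i] //; apply: val_inj.
- by exists (tnth r) => -[[|[|[|[|[|]]]]] i] //; apply: val_inj.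
- by case=> [[|[|[|[|[|]]]]] i].
- by case=> [[|[|[|[|[|]]]]] i].
Qed.

End Bridge.

(** The ring is arbitrary because the formula is evaluated at impedances, at polynomials in s, and
    at real numbers. *)
Definition bridge_num (K : pzRingType) (A B C D E : K) : K :=
  E * (A + C) * (B + D) + A * B * (C + D) + C * D * (A + B).

Definition bridge_den (K : pzRingType) (A B C D E : K) : K :=
  E * (A + B + C + D) + (A + B) * (C + D).

(** The cross-multiplied form comes from Kirchhoff's laws by elimination alone, without showing that
    the denominator is nonzero. *)
Lemma bridge_impedance (R : realType) (A B C D E : element_kind) (Z : ratfun R) :
    realizable (bridge A B C D E) Z ->
  exists (xA xB xC xD xE : R),
    let z := @element_impedance R in
    [/\ 0 < xA, 0 < xB, 0 < xC & 0 < xD /\ 0 < xE] /\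
    Z * bridge_den (z A xA) (z B xB) (z C xC) (z D xD) (z E xE)
      = bridge_num (z A xA) (z B xB) (z C xC) (z D xD) (z E xE).
Proof.
move=> [x [x_gt0 [v [f [law bal port]]]]].
pose o i (lt_i5 : (i < 5)%N) : branch (bridge A B C D E) := Ordinal lt_i5.
pose o0 := o 0%N isT; pose o1 := o 1%N isT; pose o2 := o 2%N isT.
pose o3 := o 3%N isT; pose o4 := o 4%N isT.
have sum5 (F : branch (bridge A B C D E) -> ratfun R) :
    \sum_e F e = F o0 + F o1 + F o2 + F o3 + F o4.
  rewrite !big_ord_recl big_ord0 addr0 !addrA.
  by congr (F _ + F _ + F _ + F _ + F _); apply: val_inj.
have bal0 := bal (@Ordinal 4 0 isT); have bal1 := bal (@Ordinal 4 1 isT).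
have {bal} bal2 := bal (@Ordinal 4 2 isT).
move: bal0 bal1 bal2; rewrite !net_flowE !sum5 /=.
have law0 := law o0; have law1 := law o1; have law2 := law o2.
have law3 := law o3; have {law} law4 := law o4.
exists (x o0), (x o1), (x o2), (x o3), (x o4); split; first by split; rewrite ?x_gt0.
move: law0 law1 law2 law3 law4; rewrite /bridge_num /bridge_den /src /tgt /kind /=.
rewrite !(tnth_nth ord0) !(tnth_nth A) /=.
set zA := element_impedance A _; set zB := element_impedance B _.
set zC := element_impedance C _; set zD := element_impedance D _.
set zE := element_impedance E _ => law0 law1 law2 law3 law4.
(* Vertex balance leaves two free flows, those through A and E. The two triangles of the bridge give
   two linear equations for them. *)
have f1E : f o1 = 1 - f o0 by rewrite -[1]subr0 -bal0; ring.
have f2E : f o2 = f o0 - f o4.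
  by apply: subr0_eq; rewrite -[RHS](subrr 0) -bal1; ring.
have f3E : f o3 = 1 - f o0 + f o4.
  by apply: subr0_eq; rewrite -[RHS](subrr 0) -bal2 f1E; ring.
have mesh1 : (zA + zB) * f o0 + zE * f o4 = zB.
  have : zA * f o0 + zE * f o4 - zB * f o1 = 0 by rewrite -law0 -law1 -law4; ring.
  by rewrite f1E => mesh; apply: subr0_eq; rewrite -[RHS]mesh; ring.
have mesh2 : (zC + zD) * f o0 - (zC + zD + zE) * f o4 = zD.
  have : zC * f o2 - zE * f o4 - zD * f o3 = 0 by rewrite -law2 -law3 -law4; ring.
  by rewrite f2E f3E => mesh; apply: subr0_eq; rewrite -[RHS]mesh; ring.
have -> : Z = (zA + zC) * f o0 - zC * f o4.
  have -> : Z = zA * f o0 + zC * f o2 by rewrite -law0 -law2 -port; ring.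
  by rewrite f2E; ring.
(* Cramer's rule: the determinant of the two mesh equations is, up to sign, [bridge_den], and these
   combinations of their left sides are [bridge_den] times [f o0] and [bridge_den] times [f o4]. *)
transitivity ((zA + zC) * (((zA + zB) * f o0 + zE * f o4) * (zC + zD + zE)
      + ((zC + zD) * f o0 - (zC + zD + zE) * f o4) * zE)
    - zC * (((zA + zB) * f o0 + zE * f o4) * (zC + zD)
      - ((zC + zD) * f o0 - (zC + zD + zE) * f o4) * (zA + zB))).
  by ring.
by rewrite mesh1 mesh2; ring.
Qed.

(** * Cross-multiplied polynomials *)

Section Monomials.
Variable R : realFieldType.
Implicit Types (l : seq (R * nat)) (p q a d : {poly R}) (m n : nat).

Definition monomials l : {poly R} := \sum_(t <- l) t.1 *: 'X^(t.2).

Definition positive l := all (fun t => 0 < t.1) l.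

Lemma coef_monomials l i :
  (monomials l)`_i = \sum_(t <- l) t.1 * (i == t.2)%:R.
Proof. by rewrite coef_sum; apply: eq_bigr => t _; rewrite coefZ coefXn. Qed.

(** Exponents may repeat in [l], but positive coefficients cannot cancel, so the support is exactly
    the list of exponents. *)
Lemma coef_monomials_eq0 l i : positive l ->
  ((monomials l)`_i == 0) = (i \notin unzip2 l).
Proof.
rewrite coef_monomials => l_gt0; rewrite big_seq psumr_eq0 => [|t t_l]; last first.
  by rewrite mulr_ge0 ?ler0n // ltW // (allP l_gt0).
apply/allP/idP => [coef0 | i_l t t_l].
  apply/mapP => -[t t_l i_t]; have := coef0 t t_l.
  by rewrite t_l i_t eqxx mulr1 gt_eqF // (allP l_gt0).
rewrite t_l; case: (i =P t.2) => [i_t|_]; last by rewrite mulr0 eqxx.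
by case/negP: i_l; rewrite i_t map_f.
Qed.

Lemma dvdXnp_coef p m : ('X^m %| p) <-> (forall i, (i < m)%N -> p`_i = 0).
Proof.
split=> [/dvdpP[q ->] i lt_im | p0]; first by rewrite coefMXn lt_im.
apply/dvdpP; exists (drop_poly m p); rewrite -[LHS](poly_take_drop m).
suff -> : take_poly m p = 0 by rewrite add0r.
by apply/polyP => i; rewrite coef_take_poly coef0; case: ifP => // /p0.
Qed.

(** Together with [size_monomials] this reduces lowest exponent and degree to boolean tests on
    exponents that do not mention the element values. *)
Lemma dvdXn_monomials l m : positive l ->
  ('X^m %| monomials l) = all (leq m) (unzip2 l).
Proof.
move=> l_gt0; apply/idP/allP => [/dvdXnp_coef coef0 n n_l | le_ml].
  rewrite leqNgt; apply/negP => /coef0/eqP.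
  by rewrite coef_monomials_eq0 // n_l.
apply/dvdXnp_coef => i lt_im; apply/eqP; rewrite coef_monomials_eq0 //.
by apply/negP => /le_ml /=; rewrite leqNgt lt_im.
Qed.

Lemma size_monomials l m : positive l ->
  (size (monomials l) <= m)%N = all (gtn m) (unzip2 l).
Proof.
move=> l_gt0; apply/leq_sizeP/allP => [coef0 n n_l | lt_lm].
  rewrite /= ltnNge; apply/negP => /coef0/eqP.
  by rewrite coef_monomials_eq0 // n_l.
move=> i le_mi; apply/eqP; rewrite coef_monomials_eq0 //.
by apply/negP => /lt_lm /=; rewrite ltnNge le_mi.
Qed.

Lemma coprime_Xn a m : a`_0 != 0 -> coprimep 'X^m a.
Proof.
move=> a0; apply/coprimep_expl; rewrite coprimep_sym -['X]subr0 -polyC0.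
by rewrite coprimep_XsubC rootE horner_coef0.
Qed.

Section CrossMultiplication.
Variables a d p q : {poly R}.
Hypotheses (a0 : a`_0 != 0) (d0 : d`_0 != 0) (co_ad : coprimep a d).
Hypothesis aq_dp : a * q = d * p.

(** Both [a] and [d] are coprime to every power of the variable, so such a power passes through
    [a * q = d * p] in either direction. *)
Lemma cross_dvdXn m : ('X^m %| p) = ('X^m %| q).
Proof.
rewrite -(Gauss_dvdpr p (coprime_Xn m d0)) -aq_dp.
by rewrite Gauss_dvdpr // coprime_Xn.
Qed.

Lemma cross_size : size a = size d -> size p = size q.
Proof.
have an0 : a != 0 by apply: contraNneq a0 => ->; rewrite coef0.
have dn0 : d != 0 by apply: contraNneq d0 => ->; rewrite coef0.
move=> size_ad; have : (p == 0) = (q == 0).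
  by rewrite -(inj_eq (mulfI dn0)) -aq_dp mulr0 mulf_eq0 (negPf an0).
have [-> | pn0] := eqVneq p 0; first by move/esym/eqP ->.
move/esym/negbT => qn0; have := congr1 (size : {poly R} -> nat) aq_dp.
rewrite !size_mul // size_ad => /(congr1 succn).
by rewrite !prednK ?addn_gt0 ?size_poly_gt0 ?dn0 // => /addnI.
Qed.

(** Coprimality with [d] makes [a] divide [p]; since [a] is also coprime to the power of the
    variable, the product divides [p]. *)
Lemma cross_dvdMXn m : 'X^m %| p -> (a * 'X^m) %| p.
Proof.
move=> Xm_p; rewrite Gauss_dvdp; last by rewrite coprimep_sym coprime_Xn.
by rewrite Xm_p andbT -(Gauss_dvdpr p co_ad) -aq_dp dvdp_mulIl.
Qed.

Lemma cross_spread m : p != 0 -> 'X^m %| p -> (m + size a <= size p)%N.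
Proof.
have an0 : a != 0 by apply: contraNneq a0 => ->; rewrite coef0.
move=> pn0 /cross_dvdMXn aXm_p.
by have := dvdp_leq pn0 aXm_p; rewrite (size_mulXn _ an0).
Qed.

(** Here [p] is [a * 'X^m] times a cofactor [g], linear by the size hypothesis and with nonzero
    constant term because [p] has a term of degree [m]. The same [g] divides [q], so its root is
    shared. *)
Lemma cross_root m : 'X^m %| p -> p`_m != 0 -> size p = (m + size a).+1 ->
  exists2 r, r != 0 & root p r && root q r.
Proof.
have an0 : a != 0 by apply: contraNneq a0 => ->; rewrite coef0.
move=> /cross_dvdMXn/dvdpP[g pE] pm; have gn0 : g != 0.
  by apply: contraNneq pm => g0; rewrite pE g0 mul0r coef0.
rewrite pE mulrA size_mulXn ?mulf_neq0 // size_mul // => size_g.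
have /poly2_root[r gr] : size g = 2%N.
  by move: size_g an0; rewrite -size_poly_gt0; move: (size _) (size _) => ? ?; lia.
exists r.
  apply: contraTneq gr => ->; rewrite rootE horner_coef0.
  by apply: contraNneq pm => g0; rewrite pE mulrA coefMXn ltnn subnn coef0M g0 mul0r.
have -> : q = d * g * 'X^m.
  by apply: (mulfI an0); rewrite aq_dp pE; ring.
by rewrite !rootM gr /= orbT.
Qed.

End CrossMultiplication.
End Monomials.

(* On the common zero locus, eliminating C leaves the perfect square
   (E (B + D) + D (A + B)) ^+ 2, whose root gives bridge_den the positive value
   C (A + B + E) + E A. *)
Lemma bridge_no_common_zero (R : realFieldType) (A B C D E : R) :
    0 < A -> 0 < B -> 0 < C -> 0 < E ->
    bridge_num A B C D E = 0 -> bridge_den A B C D E = 0 -> False.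
Proof.
rewrite /bridge_num /bridge_den => A_gt0 B_gt0 C_gt0 E_gt0 num0 den0.
have : (E * (B + D) + D * (A + B)) ^+ 2 = 0.
  transitivity ((E * (B + D) + A * B + D * (A + B)) *
      (E * (A + B + C + D) + (A + B) * (C + D)) - (E + A + B) *
      (E * (A + C) * (B + D) + A * B * (C + D) + C * D * (A + B))).
    by ring.
  by rewrite num0 den0 !mulr0 subrr.
move/eqP; rewrite sqrf_eq0 => /eqP x0.
have : 0 < C * (A + B + E) + E * A by nra.
suff -> : C * (A + B + E) + E * A = 0 by rewrite ltxx.
by rewrite -[RHS](subrr 0) -{1}den0 -x0; ring.
Qed.

(** * Labelings *)

(* The impedance of an element times s is a monomial of this degree. *)
Definition scaled_degree (k : element_kind) : nat :=
  match k with damper => 1 | spring => 2 | inerter => 0 end.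

Section RationalFunctions.
Variable R : realType.
Implicit Types p q : {poly R}.

Lemma to_ratfun_inj : injective (@to_ratfun R).
Proof. by move=> p q /eqP; rewrite /to_ratfun tofrac_eq => /eqP. Qed.

Lemma to_ratfunM p q : to_ratfun (p * q) = to_ratfun p * to_ratfun q.
Proof. exact: tofracM. Qed.

Lemma to_ratfunD p q : to_ratfun (p + q) = to_ratfun p + to_ratfun q.
Proof. exact: tofracD. Qed.

Lemma to_ratfun1 : to_ratfun 1 = 1 :> ratfun R.
Proof. exact: tofrac1. Qed.

Lemma to_ratfun_eq0 p : (to_ratfun p == 0) = (p == 0).
Proof. exact: tofrac_eq0. Qed.

Lemma scaled_impedance (k : element_kind) (x : R) : 0 < x ->
  element_impedance k x * to_ratfun 'X
    = to_ratfun (x^-1 *: 'X^(scaled_degree k)).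
Proof.
move=> x_gt0; have xn0 : x != 0 by rewrite gt_eqF.
have xFn0 : to_ratfun x%:P != 0 by rewrite to_ratfun_eq0 polyC_eq0.
have Xn0 : to_ratfun ('X : {poly R}) != 0 by rewrite to_ratfun_eq0 polyX_eq0.
have VC : to_ratfun (x^-1)%:P = (to_ratfun x%:P)^-1.
  by apply: (mulfI xFn0); rewrite (mulfV xFn0) -to_ratfunM -polyCM (mulfV xn0) to_ratfun1.
case: k; rewrite -!mul_polyC !to_ratfunM VC /=.
- by rewrite div1r.
- by ring.
- rewrite to_ratfun1 -mul_polyC to_ratfunM.
  move: (to_ratfun x%:P) (to_ratfun 'X) xFn0 Xn0 => u t un0 tn0.
  by rewrite mulr1 div1r invfM -mulrA (mulVf tn0) mulr1.
Qed.

End RationalFunctions.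

Section Terms.
Variables (a b c d e : nat).

(** Kirchhoff's tree formulas: the eight terms of the numerator are the complements of the two-tree
    forests separating the terminals, those of the denominator the complements of the eight spanning
    trees. *)
Definition num_degrees : seq nat :=
  [:: e + a + b; e + a + d; e + c + b; e + c + d;
      a + b + c; a + b + d; c + d + a; c + d + b]%N.

(* Degrees of s times the scaled denominator. *)
Definition den_degrees : seq nat :=
  [:: e + a + 1; e + b + 1; e + c + 1; e + d + 1;
      a + c + 1; a + d + 1; b + c + 1; b + d + 1]%N.

Variables (R : realFieldType) (A B C D E : R).

Definition num_coefs : seq R :=
  [:: E * A * B; E * A * D; E * C * B; E * C * D;
      A * B * C; A * B * D; C * D * A; C * D * B].

Definition den_coefs : seq R :=
  [:: E * A; E * B; E * C; E * D; A * C; A * D; B * C; B * D].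

Lemma bridge_num_monomials :
  bridge_num (A *: 'X^a) (B *: 'X^b) (C *: 'X^c) (D *: 'X^d) (E *: 'X^e)
    = monomials (zip num_coefs num_degrees).
Proof.
rewrite /monomials /bridge_num !big_cons big_nil /= -!mul_polyC !exprD !polyCM.
by ring.
Qed.

(** Scaling impedances by s multiplies the cubic form [bridge_num] by the cube of s but the
    quadratic form [bridge_den] only by its square; the extra factor ['X] compensates. *)
Lemma bridge_den_monomials :
  'X * bridge_den (A *: 'X^a) (B *: 'X^b) (C *: 'X^c) (D *: 'X^d) (E *: 'X^e)
    = monomials (zip den_coefs den_degrees).
Proof.
rewrite /monomials /bridge_den !big_cons big_nil /= -!mul_polyC !exprD !polyCM.
by ring.
Qed.

Lemma num_den_positive : 0 < A -> 0 < B -> 0 < C -> 0 < D -> 0 < E ->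
  positive (zip num_coefs num_degrees) && positive (zip den_coefs den_degrees).
Proof. by move=> *; rewrite /positive /= !mulr_gt0. Qed.

End Terms.

(* The condition on labelings extracted from a * q = d * p by [cross_dvdXn],
   [cross_size] and [cross_spread]; no exponent exceeds 6. *)
Definition balanced (A B C D E : element_kind) : bool :=
  let f := scaled_degree in
  let p := num_degrees (f A) (f B) (f C) (f D) (f E) in
  let q := den_degrees (f A) (f B) (f C) (f D) (f E) in
  all (fun m => [&& all (leq m) p == all (leq m) q,
                    all (gtn m) p == all (gtn m) q
                  & all (leq m) p ==> ~~ all (gtn (m + 3)) p]) (iota 0 8).

(** Abstracting realizability into a predicate [P] closed under the two symmetries leaves a finite
    check over the 243 labelings. *)
Lemma balanced_labelings (P : element_kind -> element_kind -> element_kind ->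
      element_kind -> element_kind -> Prop) :
    (forall A B C D E, P A B C D E -> P B A D C E) ->
    (forall A B C D E, P A B C D E -> P C D A B E) ->
    (forall A B C D E, P A B C D E -> balanced A B C D E) ->
    ~ P inerter spring spring damper inerter ->
    ~ P spring inerter inerter damper spring ->
  forall A B C D E, P A B C D E ->
   P damper spring damper inerter spring \/
   P damper damper inerter spring inerter \/
   P damper inerter damper spring inerter \/
   P damper damper spring inerter spring \/
   P spring damper damper inerter spring \/
   P inerter damper damper spring inerter \/
   P damper spring spring damper inerter \/
   P damper inerter inerter damper spring \/
   P damper spring spring inerter damper \/
   P damper inerter inerter spring damper \/
   P spring inerter inerter spring damper.
Proof.
move=> mirror reverse bal no1 no2 A B C D E PA.
have := bal _ _ _ _ _ PA; have P1 := mirror _ _ _ _ _ PA.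
have P2 := reverse _ _ _ _ _ PA; have P3 := reverse _ _ _ _ _ P1.
(* [balanced] computes to false for most labelings. For each remaining one, a member of its orbit of
   at most four is in the list or is one of the two excluded labelings. *)
move: PA P1 P2 P3; case: A; case: B; case: C; case: D; case: E => PA P1 P2 P3 //;
  by [tauto | case: no1 | case: no2].
Qed.

(** * Necessary conditions on a bridge realizing a cubic impedance *)

Section CubicImpedance.
Variables (R : realType) (a d : {poly R}) (Z : ratfun R).
Hypotheses (size_a : size a = 4%N) (size_d : size d = 4%N).
Hypotheses (a0 : a`_0 != 0) (d0 : d`_0 != 0) (co_ad : coprimep a d).
Hypothesis ZE : Z = to_ratfun a / to_ratfun d.

Lemma realizable_cross A B C D E : realizable (bridge A B C D E) Z ->
  exists (yA yB yC yD yE : R),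
    let z k (y : R) : {poly R} := y *: 'X^(scaled_degree k) in
    [/\ 0 < yA, 0 < yB, 0 < yC & 0 < yD /\ 0 < yE] /\
    a * ('X * bridge_den (z A yA) (z B yB) (z C yC) (z D yD) (z E yE))
      = d * bridge_num (z A yA) (z B yB) (z C yC) (z D yD) (z E yE).
Proof.
move=> /bridge_impedance[xA [xB [xC [xD [xE [[A0 B0 C0 [D0 E0]] imp]]]]]].
exists xA^-1, xB^-1, xC^-1, xD^-1, xE^-1; rewrite !invr_gt0; split=> //=.
have dFn0 : to_ratfun d != 0.
  by rewrite to_ratfun_eq0 -size_poly_gt0 size_d.
apply: to_ratfun_inj.
rewrite /bridge_num /bridge_den !(to_ratfunM, to_ratfunD) -!scaled_impedance //.
move: imp; rewrite ZE /bridge_num /bridge_den.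
move: (to_ratfun a) (to_ratfun d) (to_ratfun 'X) dFn0 => u w X wn0.
move: (element_impedance A xA) (element_impedance B xB) (element_impedance C xC)
  (element_impedance D xD) (element_impedance E xE) => zA zB zC zD zE imp.
have {imp} : u * (zE * (zA + zB + zC + zD) + (zA + zB) * (zC + zD)) =
    w * (zE * (zA + zC) * (zB + zD) + zA * zB * (zC + zD) + zC * zD * (zA + zB)).
  by rewrite -imp mulrA (mulrC w) (divfK wn0).
(* The denominator absorbs two of the three factors through its scaled impedances and the third
   through the explicit ['X]. *)
move=> imp; transitivity (X ^+ 3 *
    (u * (zE * (zA + zB + zC + zD) + (zA + zB) * (zC + zD)))); first by ring.
by rewrite imp; ring.
Qed.

Lemma realizable_balanced A B C D E :
  realizable (bridge A B C D E) Z -> balanced A B C D E.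
Proof.
move=> /realizable_cross[yA [yB [yC [yD [yE [[A0 B0 C0 [D0 E0]]]]]]]].
rewrite bridge_num_monomials bridge_den_monomials => cross.
have /andP[num_gt0 den_gt0] := num_den_positive (scaled_degree A) (scaled_degree B)
  (scaled_degree C) (scaled_degree D) (scaled_degree E) A0 B0 C0 D0 E0.
set q := monomials _ in cross; set p := monomials _ in cross.
have num_dvd m : all (leq m) (num_degrees _ _ _ _ _) = ('X^m %| p)
  := esym (dvdXn_monomials m num_gt0).
have num_size m : all (gtn m) (num_degrees _ _ _ _ _) = (size p <= m)%N
  := esym (size_monomials m num_gt0).
have den_dvd m : all (leq m) (den_degrees _ _ _ _ _) = ('X^m %| q)
  := esym (dvdXn_monomials m den_gt0).
have den_size m : all (gtn m) (den_degrees _ _ _ _ _) = (size q <= m)%N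
  := esym (size_monomials m den_gt0).
(* The size test at [m = 0] fails because the list of exponents is not empty. *)
have pn0 : p != 0 by rewrite -size_poly_gt0 ltnNge -num_size.
apply/allP => m _; rewrite !num_dvd !num_size den_dvd den_size.
rewrite (cross_dvdXn a0 d0 cross) (cross_size a0 d0 cross) ?size_a ?size_d // !eqxx /=.
rewrite -(cross_size a0 d0 cross) ?size_a ?size_d // -(cross_dvdXn a0 d0 cross).
apply/implyP => /(cross_spread a0 co_ad cross pn0).
by rewrite -ltnNge size_a addnS.
Qed.

(* The exponents run from 1 to 5, so a cubic Z needs a common root r != 0; there
   A, B, C, E take positive values, because r occurs in them to even powers. *)
Lemma even_arms_unrealizable A B C D E :
    let f := scaled_degree in
    let p := num_degrees (f A) (f B) (f C) (f D) (f E) in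
    ~~ [|| odd (f A), odd (f B), odd (f C) | odd (f E)] ->
    [&& all (leq 1) p, 1%N \in p, all (gtn 6) p & ~~ all (gtn 5) p] ->
  ~ realizable (bridge A B C D E) Z.
Proof.
move=> f p; rewrite !negb_or => /and4P[evA evB evC evE] /and4P[p_ge1 p1 p_lt6 p_5].
move=> /realizable_cross[yA [yB [yC [yD [yE [[A0 B0 C0 [D0 E0]]]]]]]] cross.
have /andP[num_gt0 _] := num_den_positive (f A) (f B) (f C) (f D) (f E) A0 B0 C0 D0 E0.
have [|||r rn0 /andP[]] := cross_root a0 d0 co_ad cross (m := 1).
- by rewrite bridge_num_monomials dvdXn_monomials.
- by rewrite bridge_num_monomials coef_monomials_eq0 // negbK.
- rewrite bridge_num_monomials size_a; apply/eqP.
  by rewrite eqn_leq size_monomials // ltnNge size_monomials // p_lt6.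
rewrite rootM rootX (negPf rn0) /= => /rootP num0 /rootP den0.
have gt0 (k : element_kind) y : ~~ odd (f k) -> 0 < y -> 0 < y * r ^+ f k.
  by move=> ev y_gt0; rewrite mulr_gt0 // exprn_even_gt0 ?rn0 ?orbT.
have := bridge_no_common_zero (gt0 _ _ evA A0) (gt0 _ _ evB B0) (gt0 _ _ evC C0)
  (D := yD * r ^+ f D) (gt0 _ _ evE E0).
by apply; [rewrite -[RHS]num0 | rewrite -[RHS]den0];
   rewrite /bridge_num /bridge_den !hornerE.
Qed.

End CubicImpedance.

(** * Series-parallel networks and the bridge graph *)

Section Configurations.
Variable N : configuration.
Implicit Types (e : branch N) (x y z u v w : vertex N) (A B : {set branch N}).

Lemma joinsC e x y : joins e x y = joins e y x.
Proof. exact: orbC. Qed.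

Lemma joins_src_tgt e : joins e (src e) (tgt e).
Proof. by rewrite /joins !eqxx. Qed.

Lemma joins_eq e x y u v :
  joins e x y -> joins e u v -> (x = u /\ y = v) \/ (x = v /\ y = u).
Proof.
by move=> /orP[/andP[/eqP <- /eqP <-] | /andP[/eqP <- /eqP <-]];
  move=> /orP[/andP[/eqP <- /eqP <-] | /andP[/eqP <- /eqP <-]]; auto.
Qed.

Lemma joins_inj e x y z : joins e x y -> joins e x z -> y = z.
Proof. by move=> /joins_eq h /h[[]|[<- ->]]. Qed.

Lemma adjacentC x y : adjacent N x y = adjacent N y x.
Proof. by apply: eq_existsb => e; rewrite joinsC. Qed.

Lemma joins_adjacent e x y : joins e x y -> adjacent N x y.
Proof. by move=> exy; apply/existsP; exists e. Qed.

Lemma ends1 e : ends [set e] = [set src e; tgt e].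
Proof. by rewrite /ends !imset_set1. Qed.

Lemma joins_ends e x y : joins e x y -> ends [set e] = [set x; y].
Proof.
by rewrite ends1 => /orP[] /andP[/eqP -> /eqP ->] //; rewrite setUC.
Qed.

Lemma endsU A B : ends (A :|: B) = ends A :|: ends B.
Proof. by rewrite /ends !imsetU setUACA. Qed.

Lemma mem_ends A v : reflect (exists2 e, e \in A & v \in ends [set e]) (v \in ends A).
Proof.
apply: (iffP setUP) => [[] /imsetP[e eA ->] | [e eA]].
- by exists e; rewrite // ends1 !inE eqxx.
- by exists e; rewrite // ends1 !inE eqxx orbT.
- by rewrite ends1 !inE => /orP[] /eqP ->; [left | right]; apply: imset_f.
Qed.

Lemma sp_between_sym A x y : sp_between A x y -> sp_between A y x.
Proof.
elim=> {A x y} [e x y xy exy | A B x y z _ spA _ spB dAB eAB | A B x y _ spA _ spB dAB eAB].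
- by apply: SpSingle; rewrite 1?eq_sym // joinsC.
- by rewrite setUC; apply: SpSeries spB spA _ _; rewrite 1?disjoint_sym // setIC.
- by apply: SpParallel => //; rewrite eAB setUC.
Qed.

Lemma sp_between_ends A x y :
  sp_between A x y -> (x \in ends A) && (y \in ends A).
Proof.
elim=> {A x y} [e x y _ /joins_ends-> | A B x y z _ /andP[xA _] _ /andP[_ zB] _ _
  | A B x y _ /andP[xA yA] _ _ _ _].
- by rewrite !inE !eqxx orbT.
- by rewrite endsU 2!(in_setU _ (ends A)) xA zB orbT.
- by rewrite endsU 2!(in_setU _ (ends A)) xA yA.
Qed.

(** This weak inversion keeps only how the vertex sets of the two parts meet, which is enough to
    exclude the bridge. *)
Lemma sp_between_split A x z : sp_between A x z ->
  (exists e, A = [set e]) \/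
  exists A1 A2 y, [/\ A = A1 :|: A2, A1 != set0, A2 != set0
    & ends A1 :&: ends A2 = [set y] \/ ends A1 :&: ends A2 = [set x; z]].
Proof.
have neq0 B u v : sp_between B u v -> B != set0.
  move/sp_between_ends/andP=> [/mem_ends[e eB _] _].
  by apply/set0Pn; exists e.
case=> {A x z} [e x y _ _ | A B x y z spA spB _ eAB | A B x y spA spB _ eAB].
- by left; exists e.
- by right; exists A, B, y; split; [|exact: neq0 spA|exact: neq0 spB|left].
- by right; exists A, B, x; split; [|exact: neq0 spA|exact: neq0 spB|right].
Qed.

(** This is the invariant of the reduction. Merging a series pair keeps the vertex type and isolates
    the middle vertex, so connectivity is lost while this property survives. *)
Definition all_on_simple_paths : Prop :=
  terminal N != terminal' N /\ forall e : branch N, on_simple_path e.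

Definition internal w := (w != terminal N) && (w != terminal' N).

End Configurations.

Section BridgeGraph.
Variables A B C D E : element_kind.
Let N := bridge A B C D E.
Let v0 : vertex N := @Ordinal 4 0 isT.
Let v1 : vertex N := @Ordinal 4 1 isT.
Let v2 : vertex N := @Ordinal 4 2 isT.
Let v3 : vertex N := @Ordinal 4 3 isT.
Let b0 : branch N := @Ordinal 5 0 isT.
Let b1 : branch N := @Ordinal 5 1 isT.
Let b2 : branch N := @Ordinal 5 2 isT.
Let b3 : branch N := @Ordinal 5 3 isT.
Let b4 : branch N := @Ordinal 5 4 isT.

Lemma bridge_branchP (P : branch N -> Prop) :
  P b0 -> P b1 -> P b2 -> P b3 -> P b4 ->
  forall e, P e.
Proof.
by move=> P0 P1 P2 P3 P4 [[|[|[|[|[|]]]]] lt_i5] //;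
  [move: P0 | move: P1 | move: P2 | move: P3 | move: P4];
  congr (P _); apply: val_inj.
Qed.

Lemma bridge_is_network : is_network N.
Proof.
have adj e x y : @joins N e x y -> adjacent N x y by apply: joins_adjacent.
have a01 : adjacent N v0 v1 by apply: (adj b0).
have a02 : adjacent N v0 v2 by apply: (adj b1).
have a13 : adjacent N v1 v3 by apply: (adj b2).
have a23 : adjacent N v2 v3 by apply: (adj b3).
have a12 : adjacent N v1 v2 by apply: (adj b4).
split=> // [x y | ].
  have conC := sym_connect_sym (@adjacentC N).
  suff con0 z : connect (adjacent N) v0 z.
    by apply: connect_trans (con0 y); rewrite conC.
  case: z => -[|[|[|[|]]]] // lt_i4.
  - by apply: eq_connect0; apply: val_inj.
  - by apply: connect1; rewrite (_ : Ordinal _ = v1) //; apply: val_inj.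
  - by apply: connect1; rewrite (_ : Ordinal _ = v2) //; apply: val_inj.
  apply: connect_trans (connect1 a01) _; apply: connect1.
  by rewrite (_ : Ordinal _ = v3) //; apply: val_inj.
apply: bridge_branchP.
- by exists [::], [:: v3], v1; rewrite /= a01 a13.
- by exists [::], [:: v3], v2; rewrite /= a02 a23.
- by exists [:: v1], [::], v3; rewrite /= a01 a13.
- by exists [:: v2], [::], v3; rewrite /= a02 a23.
- by exists [:: v1], [:: v3], v2; rewrite /= a01 a12 a23.
Qed.

(** Two shared vertices rule out a series split, and a shared internal vertex rules out a parallel
    split. *)
Lemma bridge_split (S T : {set branch N}) :
    S :|: T = setT -> S != set0 -> T != set0 ->
  exists x y, [/\ x != y, internal x, x \in ends S :&: ends T
    & y \in ends S :&: ends T].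
Proof.
move=> ST.
have mem e : (e \in S) || (e \in T) by rewrite -in_setU ST inE.
(* With E in [S], both internal vertices are ends of [S], and every branch of [T] touches at least
   one of them. *)
wlog b4S : S T ST mem / b4 \in S.
  move=> IH S0 T0; case/orP: (mem b4) => b4S; first exact: IH.
  rewrite setIC; apply: IH => // [|e]; first by rewrite setUC.
  by rewrite orbC.
move=> _ /set0Pn[e].
have end_src (e' : branch N) (U : {set branch N}) : e' \in U -> src e' \in ends U.
  by move=> eU; apply/mem_ends; exists e'; rewrite // ends1 !inE eqxx.
have end_tgt (e' : branch N) (U : {set branch N}) : e' \in U -> tgt e' \in ends U.
  by move=> eU; apply/mem_ends; exists e'; rewrite // ends1 !inE eqxx orbT.
have s1 := end_src _ _ b4S; have s2 := end_tgt _ _ b4S.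
have out x y : x != y -> internal x -> x \in ends S -> x \in ends T ->
    y \in ends S -> y \in ends T ->
    exists x y, [/\ x != y, internal x, x \in ends S :&: ends T
      & y \in ends S :&: ends T].
  by move=> *; exists x, y; split; rewrite // inE; apply/andP.
(* If [e] is an arm, consider the other arm at its terminal: if it lies in [S], that terminal is the
   second shared vertex; if it lies in [T], the other internal vertex is. *)
move: e; apply: bridge_branchP => eT; have e_src := end_src _ _ eT;
  have e_tgt := end_tgt _ _ eT.
- case/orP: (mem b1) => h; have h_src := end_src _ _ h; have h_tgt := end_tgt _ _ h.
    exact: (out v1 v0).
  exact: (out v1 v2).
- case/orP: (mem b0) => h; have h_src := end_src _ _ h; have h_tgt := end_tgt _ _ h.
    exact: (out v2 v0).
  exact: (out v2 v1).
- case/orP: (mem b3) => h; have h_src := end_src _ _ h; have h_tgt := end_tgt _ _ h.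
    exact: (out v1 v3).
  exact: (out v1 v2).
- case/orP: (mem b2) => h; have h_src := end_src _ _ h; have h_tgt := end_tgt _ _ h.
    exact: (out v2 v3).
  exact: (out v2 v1).
- exact: (out v1 v2).
Qed.

Lemma bridge_not_series_parallel : ~ series_parallel N.
Proof.
move=> /sp_between_split[[e eT] | [S [T [y [/esym ST S0 T0 ST_ends]]]]].
  by have := congr1 (fun U : {set branch N} => #|U|) eT; rewrite cards1 cardsT card_ord.
have [u [w [uw /andP[u_a u_a'] uST wST]]] := bridge_split ST S0 T0.
case: ST_ends uST wST => ->; rewrite !inE; last by rewrite (negPf u_a) (negPf u_a').
by move=> /eqP u_y /eqP w_y; rewrite u_y w_y eqxx in uw.
Qed.

End BridgeGraph.

(** * Merging parallel and series pairs *)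

Section Substitution.
Variables (N : configuration) (B' : finType) (s t : B' -> vertex N).
Variables (k : B' -> element_kind) (phi : B' -> {set branch N}).
Let N' := Configuration s t k (terminal N) (terminal' N).
Hypothesis phi_sp : forall e, sp_between (phi e) (s e) (t e).
Hypothesis phi_disjoint : forall e e', e != e' -> [disjoint phi e & phi e'].
Hypothesis phi_ends : forall e e', e != e' ->
  ends (phi e) :&: ends (phi e') \subset [set s e; t e] :&: [set s e'; t e'].

Let Phi (A : {set B'}) := \bigcup_(e in A) phi e.

Let Phi_disjoint (A C : {set B'}) : [disjoint A & C] -> [disjoint Phi A & Phi C].
Proof.
move=> dAC; apply/pred0P => f /=; apply/negP => /andP[/bigcupP[e eA fe] /bigcupP[e' eC fe']].
have ee' : e != e' by apply: contraTneq eC => <-; rewrite (disjointFr dAC).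
by rewrite (disjointFr (phi_disjoint ee') fe) in fe'.
Qed.

(** Distinct blocks [phi e] meet only in their own terminals, so disjoint unions of blocks share the
    same vertices as the branches they replace. This carries over the side conditions of the series
    and parallel rules. *)
Let Phi_ends (A C : {set B'}) : [disjoint A & C] ->
  ends (Phi A) :&: ends (Phi C) = @ends N' A :&: @ends N' C.
Proof.
have endsP (F : {set B'}) x :
    reflect (exists2 e, e \in F & x \in ends (phi e)) (x \in ends (Phi F)).
  apply: (iffP (mem_ends _ _)) => [[f /bigcupP[e eF fe] xf] | [e eF /mem_ends[f fe xf]]].
    by exists e => //; apply/mem_ends; exists f.
  by exists f => //; apply/bigcupP; exists e.
have sub e : [set s e; t e] \subset ends (phi e).
  by apply/subsetP => x; have /andP[se te] := sp_between_ends (phi_sp e);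
    rewrite in_set2 => /orP[] /eqP->.
have endsP' (F : {set B'}) x :
    reflect (exists2 e, e \in F & x \in [set s e; t e]) (x \in @ends N' F).
  apply: (iffP (mem_ends _ _)) => -[e eF xe]; exists e => //; last by rewrite ends1.
  by rewrite ends1 in xe.
move=> dAC; apply/setP => x; apply/setIP/setIP => -[].
  move=> /endsP[e eA xe] /endsP[e' eC xe'].
  have ee' : e != e' by apply: contraTneq eC => <-; rewrite (disjointFr dAC).
  have /(subsetP (phi_ends ee'))/setIP[xe1 xe'1] : x \in ends (phi e) :&: ends (phi e').
    by apply/setIP.
  by split; apply/endsP'; [exists e | exists e'].
move=> /endsP'[e eA /(subsetP (sub e)) xe] /endsP'[e' eC /(subsetP (sub e')) xe'].
by split; apply/endsP; [exists e | exists e'].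
Qed.

Lemma sp_between_substitute A x y :
  @sp_between N' A x y -> sp_between (\bigcup_(e in A) phi e) x y.
Proof.
elim=> {A x y} [e x y _ | A C x y z _ spA _ spC dAC eAC | A C x y _ spA _ spC dAC eAC].
- rewrite big_set1 => /orP[] /andP[/eqP <- /eqP <-] //=.
  exact: sp_between_sym.
- rewrite bigcup_setU; apply: SpSeries spA spC (Phi_disjoint dAC) _.
  by rewrite Phi_ends.
- rewrite bigcup_setU; apply: SpParallel spA spC (Phi_disjoint dAC) _.
  by rewrite Phi_ends.
Qed.

End Substitution.

Section Merge.
Variables (N : configuration) (e1 e2 : branch N) (u v : vertex N).

(* Branches e1 and e2 are replaced by a single branch, named e1, from u to v. *)
Definition merge_branches : configuration :=
  @Configuration (vertex N) {e : branch N | e != e2}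
    (fun e => if val e == e1 then u else src (val e))
    (fun e => if val e == e1 then v else tgt (val e))
    (fun e => kind (val e)) (terminal N) (terminal' N).

Hypothesis e12 : e1 != e2.

Lemma card_merge : #|branch merge_branches|.+1 = #|branch N|.
Proof.
rewrite /= card_sig -[RHS](cardC (pred1 e2)) card1 add1n; congr _.+1.
Qed.

Lemma joins_merge (e : branch N) (e_e2 : e != e2) x y :
  @joins merge_branches (Sub e e_e2) x y
    = if e == e1 then ((u == x) && (v == y)) || ((u == y) && (v == x)) else joins e x y.
Proof. by rewrite /joins /=; case: ifP. Qed.

(** The pair is substituted for the merged branch and every other branch for itself. The last
    condition on [ends] says that the pair meets the rest of the network only in [u] and [v]. *)
Lemma series_parallel_merge :
    (forall e : branch N, src e != tgt e) ->
    sp_between [set e1; e2] u v ->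
    (forall e, e != e1 -> e != e2 ->
       ends [set e1; e2] :&: ends [set e] \subset [set u; v]) ->
  series_parallel merge_branches -> series_parallel N.
Proof.
move=> noloop sp12 ends12 spM.
pose phi (e : branch merge_branches) := if val e == e1 then [set e1; e2] else [set val e].
have phi_sp e : sp_between (phi e) (src e) (tgt e).
  rewrite /phi /=; case: ifP => // _.
  by apply: SpSingle; rewrite ?joins_src_tgt.
have val_neq (e e' : branch merge_branches) : e != e' -> val e != val e'.
  by rewrite (inj_eq val_inj).
have phiP e g : g \in phi e -> g = val e \/ (val e = e1 /\ g = e2).
  rewrite /phi; case: eqP => [->|_]; last by rewrite inE => /eqP; left.
  by rewrite !inE => /orP[] /eqP->; [left | right].
have phi_disjoint e e' : e != e' -> [disjoint phi e & phi e'].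
  move=> /val_neq/eqP ee'; apply/pred0P => g /=; apply/negP => /andP[].
  have e_e2 := valP e; have e'_e2 := valP e'.
  move=> /phiP[-> | [e_e1 ->]] /phiP[e_e' | [e'_e1 e2E]] //.
  - by rewrite /= e2E eqxx in e_e2.
  - by rewrite /= -e_e' eqxx in e'_e2.
  - by apply: ee'; rewrite e_e1.
have ends_sub (e e' : branch merge_branches) x : e != e' ->
    x \in ends (phi e) -> x \in ends (phi e') ->
    x \in [set src e; tgt e].
  move=> /val_neq ee'; rewrite /phi /=; case: eqP => [e_e1 | _]; last by rewrite ends1.
  have e'_e1 : val e' != e1 by rewrite -e_e1 eq_sym.
  rewrite (negPf e'_e1) => xe xe'.
  have /subsetP sub := ends12 _ e'_e1 (valP e').
  by apply: sub; apply/setIP.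
have phi_ends e e' : e != e' -> ends (phi e) :&: ends (phi e')
    \subset [set src e; tgt e] :&: [set src e'; tgt e'].
  move=> ee'; apply/subsetP => x /setIP[xe xe']; apply/setIP; split.
    exact: ends_sub xe'.
  by apply: ends_sub xe; rewrite // eq_sym.
have := sp_between_substitute phi_sp phi_disjoint phi_ends spM.
rewrite /series_parallel; congr (sp_between _ _ _).
apply/setP => f; rewrite inE; apply/bigcupP.
have [-> | f_e2] := eqVneq f e2.
  exists (Sub e1 e12); rewrite ?inE // /phi SubK eqxx !inE eqxx orbT //.
exists (Sub f f_e2); rewrite ?inE // /phi SubK.
by case: eqP => [->|_]; rewrite !inE eqxx.
Qed.

End Merge.

(** A loop would force two consecutive vertices of a path with distinct vertices to coincide. *)
Lemma simple_path_no_loop (N : configuration) (e : branch N) :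
  on_simple_path e -> src e != tgt e.
Proof.
move=> [p1 [p2 [y [_ _]]]]; rewrite -cat_cons cat_uniq => /and3P[_ + _] ey.
rewrite /= negb_or => /andP[y_p1 _].
have := mem_last (terminal N) p1; case/orP: ey => /andP[/eqP-> /eqP->] lp1.
  by apply: contraNneq y_p1 => <-.
by apply: contraNneq y_p1 => ->.
Qed.

(** Dropping one of two parallel branches does not change adjacency, so the old simple paths remain
    valid. *)
Lemma parallel_merge_paths (N : configuration) (e1 e2 : branch N) :
    e1 != e2 -> joins e2 (src e1) (tgt e1) ->
    all_on_simple_paths N ->
  all_on_simple_paths (merge_branches e1 e2 (src e1) (tgt e1)).
Proof.
move=> e12 e2j [aa' sp]; split=> // e'.
set N' := merge_branches _ _ _ _.
have joinsE (e : branch N') x y : joins e x y = joins (val e) x y.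
  by rewrite /joins /=; case: (val e =P e1) => // ->.
have adjE x y : adjacent N' x y = adjacent N x y.
  apply/existsP/existsP => -[e]; first by rewrite joinsE; exists (val e).
  have [-> | e_e2] := eqVneq e e2 => exy; last by exists (Sub e e_e2); rewrite joinsE.
  exists (Sub e1 e12); rewrite joinsE SubK.
  by have [[-> ->]|[-> ->]] := joins_eq exy e2j; rewrite ?joins_src_tgt // joinsC joins_src_tgt.
have [p1 [p2 [y [path_p last_p uniq_p ey]]]] := sp (val e').
exists p1, p2, y; split; rewrite ?joinsE // (eq_path adjE) //.
Qed.

Lemma uniq_cat_notin (T : eqType) (s t : seq T) x :
  uniq (s ++ t) -> x \in t -> x \notin s.
Proof. by rewrite cat_uniq => /and3P[_ /hasPn disj _] /disj. Qed.

(** Deleting [w] from a simple path of [N] gives one in the merged network: a path through [w] must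
    use both [u] and [v] as its neighbours there, and these are now adjacent. *)
Lemma series_merge_paths (N : configuration) (e1 e2 : branch N) (u v w : vertex N) :
    e1 != e2 -> internal w -> joins e1 u w -> joins e2 w v -> u != v ->
    (forall e x, joins e w x -> e = e1 \/ e = e2) ->
    all_on_simple_paths N ->
  all_on_simple_paths (merge_branches e1 e2 u v).
Proof.
move=> e12 w_int e1uw e2wv uv incw [aa' sp]; split=> // e'.
set N' := merge_branches _ _ _ _.
have new : joins (Sub e1 e12 : branch N') u v by rewrite joins_merge eqxx !eqxx.
have adj_uv : adjacent N' u v by apply: joins_adjacent new.
have nb_w x : adjacent N w x -> x = u \/ x = v.
  move=> /existsP[e ewx]; have [E | E] := incw _ _ ewx; rewrite E in ewx.
    by left; apply: joins_inj ewx _; rewrite joinsC.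
  by right; apply: joins_inj ewx _.
have skip x y : adjacent N x w -> adjacent N w y -> x != y -> adjacent N' x y.
  rewrite adjacentC => /nb_w xE /nb_w yE; case: xE yE => -> [] -> //; rewrite ?eqxx //.
  by rewrite adjacentC.
have keep x y : x != w -> y != w -> adjacent N x y -> adjacent N' x y.
  move=> xw yw /existsP[e exy].
  have e_e1 : e != e1.
    apply: contraNneq xw => E; rewrite E in exy.
    by have [[_ yE]|[->]//] := joins_eq exy e1uw; rewrite yE eqxx in yw.
  have e_e2 : e != e2.
    apply: contraNneq xw => E; rewrite E in exy.
    by have [[->]//|[_ yE]] := joins_eq exy e2wv; rewrite yE eqxx in yw.
  apply: (@joins_adjacent N' (Sub e e_e2)).
  by rewrite joins_merge (negPf e_e1).
(* Induction on the length bound rather than on the list, since skipping [w] consumes two vertices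
   at once. *)
have bypass p x : path (adjacent N) x p -> uniq (x :: p) -> x != w ->
    last x p != w -> path (adjacent N') x (filter (predC1 w) p).
  elim: {p}(size p) {-2}p (leqnn (size p)) x => [|n IH] [|y p] //= le_pn x.
  move=> /andP[xy path_p] /andP[x_p /andP[y_p uniq_p]] xw last_p.
  have [yw | yw] := eqVneq y w; last first.
    by rewrite /= keep // IH //= y_p.
  case: p => [|z p] /= in le_pn path_p x_p y_p uniq_p last_p *.
    by rewrite yw eqxx in last_p.
  case/andP: path_p => yz path_p.
  have zw : z != w by apply: contraNneq y_p => ->; rewrite yw mem_head.
  have ze : adjacent N' x z.
    by apply: skip; rewrite -?yw //; apply: contraNneq x_p => ->; rewrite !inE eqxx orbT.
  by rewrite zw /= ze; apply: IH => //; apply: ltnW.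
have keep_cat p1 y p2 : y != w ->
    filter (predC1 w) (p1 ++ y :: p2)
      = filter (predC1 w) p1 ++ y :: filter (predC1 w) p2.
  by move=> yw; rewrite filter_cat /= yw.
have keep_last p x : last x p != w -> last x (filter (predC1 w) p) = last x p.
  elim/last_ind: p => // p y _; rewrite last_rcons => yw.
  by rewrite filter_rcons /= yw last_rcons.
case/andP: w_int => aw a'w.
have [p1 [p2 [y [path_p last_p uniq_p ey]]]] := sp (val e').
set a := terminal N in aw aa' path_p last_p uniq_p ey *.
set p := p1 ++ y :: p2 in path_p last_p uniq_p.
have finish q1 z q2 : filter (predC1 w) p = q1 ++ z :: q2 ->
    joins e' (last a q1) z -> on_simple_path e'.
  move=> pE e'z; exists q1, q2, z; rewrite -pE; split=> //.
  - by apply: bypass => //; rewrite ?last_p eq_sym.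
  - by rewrite keep_last last_p // eq_sym.
  - have -> : terminal N' :: filter (predC1 w) p = filter (predC1 w) (a :: p).
      by rewrite /= [a == w]eq_sym aw.
    exact: filter_uniq.
(* A branch other than the merged one does not touch [w], so its two ends stay consecutive after the
   deletion. *)
have [e'_e1 | e'_e1] := eqVneq (val e') e1; last first.
  have e'_w x : ~~ joins (val e') w x.
    by apply/negP => /incw[] /eqP; rewrite ?(negPf e'_e1) // (negPf (valP e')).
  have yw : y != w by apply: contraNneq (e'_w (last a p1)) => <-; rewrite joinsC.
  have lw : last a p1 != w by apply: contraNneq (e'_w y) => <-.
  apply: (finish (filter (predC1 w) p1) y (filter (predC1 w) p2)).
    exact: keep_cat.
  rewrite keep_last //; case: (e') e'_e1 ey => f f_e2 /= f_e1 ey'.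
  by rewrite joins_merge (negPf f_e1).
have {}new x z : (x = u /\ z = v) \/ (x = v /\ z = u) -> joins e' x z.
  rewrite (_ : e' = Sub e1 e12); last exact: val_inj.
  by case=> -[-> ->] //; rewrite joinsC.
rewrite e'_e1 in ey.
(* If the path runs from [u] to [w], it continues because [w] is not a terminal, and its next vertex
   is [v], as [u] has already been visited. *)
have {ey} [[lp1 yE] | [lp1 yE]] := joins_eq ey e1uw.
  case: p2 => [|z p2] in p path_p last_p uniq_p finish *.
    by move: last_p; rewrite last_cat /= yE => wE; rewrite -wE eqxx in a'w.
  move: path_p uniq_p; rewrite /p yE cat_path -cat_cons.
  move=> /andP[_ path_wz] uniq_p; have /= /and3P[_ wz _] := path_wz.
  have disj x := uniq_cat_notin (x := x) uniq_p.
  have w_zp2 : w \notin z :: p2.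
    by move: uniq_p; rewrite cat_uniq => /and3P[_ _] /= /andP[].
  have uw : u != w.
    by have := disj w (mem_head _ _); apply: contraNneq => <-; rewrite -lp1 mem_last.
  have zw : z != w by apply: contraNneq w_zp2 => ->; rewrite mem_head.
  have zu : z != u.
    have := disj z; rewrite !inE eqxx orbT => /(_ isT).
    by apply: contraNneq => ->; rewrite -lp1; apply: mem_last.
  apply: (finish (filter (predC1 w) p1) z (filter (predC1 w) p2)).
    by rewrite /p yE filter_cat /= eqxx zw.
  apply: new; left; rewrite keep_last lp1 //; split=> //.
  by have [zE|//] := nb_w z wz; rewrite zE eqxx in zu.
case/lastP: p1 => [|q x] in p path_p last_p uniq_p finish lp1 *.
  by move: aw; rewrite -lp1 eqxx.
rewrite last_rcons in lp1; move: path_p uniq_p.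
rewrite /p lp1 yE cat_rcons cat_path -cat_cons.
move=> /andP[_ path_wu] uniq_p; have /= /and3P[qw _ _] := path_wu.
have disj x := uniq_cat_notin (x := x) uniq_p.
have w_up2 : w \notin u :: p2.
  by move: uniq_p; rewrite cat_uniq => /and3P[_ _] /= /andP[].
have uw : u != w by apply: contraNneq w_up2 => ->; rewrite mem_head.
have lw : last a q != w.
  by have := disj w (mem_head _ _); apply: contraNneq => <-; rewrite mem_last.
have lu : last a q != u.
  have := disj u; rewrite !inE eqxx orbT => /(_ isT).
  by apply: contraNneq => <-; apply: mem_last.
apply: (finish (filter (predC1 w) q) u (filter (predC1 w) p2)).
  by rewrite /p lp1 yE cat_rcons filter_cat /= eqxx uw.
apply: new; right; rewrite keep_last //; split=> //.
by rewrite adjacentC in qw; have [lE|//] := nb_w _ qw; rewrite lE eqxx in lu.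
Qed.

(** * Irreducible networks *)

Definition incident (N : configuration) (w : vertex N) : {set branch N} :=
  [set e | (src e == w) || (tgt e == w)].

Definition neighbours (N : configuration) (w : vertex N) : {set vertex N} :=
  [set x | adjacent N w x].

(** That these five branches are all of them is supplied by the bound of five on the number of
    branches. *)
Definition bridge_shaped (N : configuration) : Prop :=
  exists (w w' : vertex N) (eA eB eC eD eE : branch N),
  [/\ uniq [:: terminal N; w; w'; terminal' N],
      joins eA (terminal N) w /\ joins eB (terminal N) w',
      joins eC w (terminal' N), joins eD w' (terminal' N) & joins eE w w'].

Section SimplePaths.
Variable N : configuration.
Implicit Types (e : branch N) (w x y : vertex N).

Lemma incidentP e w : reflect (exists x, joins e w x) (e \in incident w).
Proof.
rewrite inE; apply: (iffP orP) => [[] /eqP <- | [x /orP[] /andP[se te]]].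
- by exists (tgt e); apply: joins_src_tgt.
- by exists (src e); rewrite joinsC joins_src_tgt.
- by left.
- by right.
Qed.

Lemma joins_incident e x y : joins e x y -> e \in incident x.
Proof. by move=> exy; apply/incidentP; exists y. Qed.

Lemma adjacent_incident x y : adjacent N x y -> incident x != set0.
Proof.
by move=> /existsP[e exy]; apply/set0Pn; exists e; apply: joins_incident exy.
Qed.

(** A simple path through [e] both enters and leaves the internal vertex [w]; using [e] twice would
    repeat a vertex. *)
Lemma internal_two_incident e w : on_simple_path e ->
  internal w -> e \in incident w -> exists2 e', e' \in incident w & e' != e.
Proof.
move=> [p1 [p2 [y [path_p last_p uniq_p ey]]]] /andP[aw a'w] /incidentP[x ewx].
have [[wE xE] | [wE xE]] := joins_eq ewx ey; rewrite {x}xE in ewx.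
  (* When the path leaves [w] along [e], the other branch comes from the predecessor of [w]; in the
     second case it leads to the successor. *)
  case/lastP: p1 => [|p1 z] in path_p {last_p} uniq_p ey wE ewx *.
    by rewrite wE eqxx in aw.
  rewrite last_rcons in wE ewx ey; rewrite -wE cat_rcons in path_p uniq_p.
  move: path_p; rewrite cat_path => /andP[_ /= /and3P[/existsP[e' e'w] _ _]].
  exists e'; first by move: e'w; rewrite joinsC; apply: joins_incident.
  apply: contraTneq uniq_p => e'E; rewrite e'E joinsC in e'w.
  rewrite -(joins_inj e'w ewx) -cat_cons; apply: contraL (mem_last _ _).
  by move=> /uniq_cat_notin; apply; rewrite !inE eqxx orbT.
case: p2 => [|z p2] in path_p last_p uniq_p *.
  by rewrite last_cat /= -wE in last_p; rewrite last_p eqxx in a'w.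
rewrite -wE in path_p uniq_p ey.
move: path_p; rewrite cat_path => /andP[_ /= /and3P[_ /existsP[e' wz] _]].
exists e'; first exact: joins_incident wz.
apply: contraTneq uniq_p => e'E; rewrite e'E in wz.
rewrite -(joins_inj ewx wz) -cat_cons; apply: contraL (mem_last _ _).
by move=> /uniq_cat_notin; apply; rewrite !inE eqxx orbT.
Qed.

Lemma terminals_incident e : on_simple_path e ->
  incident (terminal N) != set0 /\ incident (terminal' N) != set0.
Proof.
move=> [p1 [p2 [y [path_p last_p _ _]]]]; split.
  by case: p1 path_p {last_p} => [|z p1] /= /andP[+ _]; apply: adjacent_incident.
rewrite last_cat /= in last_p; move: path_p.
rewrite lastI -rcons_cat rcons_path last_p adjacentC => /andP[_].
exact: adjacent_incident.
Qed.

End SimplePaths.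

Section Irreducible.
Variable N : configuration.
Implicit Types (e : branch N) (w x y : vertex N).
Hypothesis paths : all_on_simple_paths N.
Hypothesis no_parallel : forall e e' x y, joins e x y -> joins e' x y -> e = e'.
Hypothesis no_series : forall w, internal w -> #|incident w| != 2.
Hypothesis card_le5 : (#|branch N| <= 5)%N.

Let aa' : terminal N != terminal' N. Proof. by case: paths. Qed.

Let noloop e : src e != tgt e.
Proof. by apply: simple_path_no_loop; case: paths. Qed.

Lemma neighbours_irrefl w : w \notin neighbours w.
Proof.
rewrite inE; apply/existsP => -[e /orP[] /andP[/eqP se /eqP te]];
  by have := noloop e; rewrite se te eqxx.
Qed.

(** Without parallel branches, a branch at [w] is determined by its other end. *)
Lemma incident_le_neighbours w : (#|incident w| <= #|neighbours w|)%N.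
Proof.
pose other e := if src e == w then tgt e else src e.
have joins_other e : e \in incident w -> joins e w (other e).
  rewrite inE /other; case: eqP => [<- _ | _ /= /eqP <-]; first exact: joins_src_tgt.
  by rewrite joinsC joins_src_tgt.
rewrite -(card_in_imset (f := other)) => [|e e' ew e'w ee']; last first.
  by apply: no_parallel (joins_other _ ew) _; rewrite ee'; apply: joins_other.
apply/subset_leq_card/subsetP => _ /imsetP[e ew ->].
by rewrite inE; apply: joins_adjacent (joins_other _ ew).
Qed.

Lemma irreducible_degree w : internal w -> incident w != set0 -> (2 < #|incident w|)%N.
Proof.
move=> w_int /set0Pn[e ew]; rewrite ltn_neqAle eq_sym no_series //=.
case: paths => _ /(_ e) path_e; have [e' e'w e'e] := internal_two_incident path_e w_int ew.
have <- : #|[set e; e']| = 2%N by rewrite cards2 eq_sym e'e.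
by apply/subset_leq_card/subsetP => f /set2P[] ->.
Qed.

(** Handshake identity: in the absence of loops each branch is counted at exactly two vertices. *)
Lemma sum_incident : (\sum_(w : vertex N) #|incident w| = #|branch N| * 2)%N.
Proof.
under eq_bigr => w _ do rewrite -sum1_card.
rewrite (exchange_big_dep predT) //= -sum_nat_const; apply: eq_bigr => e _.
rewrite sum1_card -(_ : #|[set src e; tgt e]| = 2%N); last by rewrite cards2 noloop.
by apply: eq_card => w; rewrite -[LHS]/(e \in incident w) !inE ![w == _]eq_sym.
Qed.

(** Vertices isolated by earlier series merges are left out. *)
Definition inner := [set w : vertex N | internal w & incident w != set0].

(** The degree sum is at most ten. Both terminals contribute at least one and each inner vertex at
    least three, so three inner vertices would require eleven. *)
Lemma card_inner : branch N -> (#|inner| <= 2)%N.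
Proof.
move=> e; case: paths => _ /(_ e) /terminals_incident[].
rewrite -!card_gt0 => deg_a deg_a'.
have inner_deg : (#|inner| * 3 <= \sum_(w : vertex N | internal w) #|incident w|)%N.
  rewrite -sum_nat_const.
  apply: (@leq_trans (\sum_(w in inner) #|incident w|)%N).
    by apply: leq_sum => w; rewrite inE => /andP[]; apply: irreducible_degree.
  rewrite [leqRHS](bigID [in inner]) /=; apply: leq_trans (leq_addr _ _).
  rewrite (eq_bigl (fun w => internal w && (w \in inner))) // => w.
  by rewrite inE; case: (internal w).
have := sum_incident; rewrite (bigD1 (terminal N)) //= (bigD1 (terminal' N)) /=; last first.
  by rewrite eq_sym aa'.
move: inner_deg; rewrite /internal => inner_deg deg_sum.
move: deg_a deg_a' inner_deg card_le5 deg_sum.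
move: #|incident (terminal N)| #|incident (terminal' N)| #|inner| #|branch N|.
by move: (\sum_(w | _) _)%N => *; lia.
Qed.

Lemma irreducible_bridge_shaped :
  (1 < #|branch N|)%N -> bridge_shaped N.
Proof.
move=> card_gt1.
have [e [e' [_ _ ee']]] := card_gt1P card_gt1.
(* Without inner vertices every branch would join the two terminals, making two distinct branches
   parallel. *)
have [w w_inner] : exists w, w \in inner.
  apply/set0Pn; apply: contra_neqN ee' => inner0.
  have touch f : joins f (terminal N) (terminal' N).
    have out x : f \in incident x -> (x == terminal N) || (x == terminal' N).
      move=> fx; apply: contraTT inner0; rewrite negb_or => x_int.
      by apply/set0Pn; exists x; rewrite inE /internal x_int; apply/set0Pn; exists f.
    have /out src_f := joins_incident (joins_src_tgt f).
    have /out tgt_f : f \in incident (tgt f) by rewrite inE eqxx orbT.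
    move: (noloop f); rewrite /joins.
    by case/orP: src_f => /eqP->; case/orP: tgt_f => /eqP->; rewrite !eqxx ?orbT.
  exact: no_parallel (touch e) (touch e').
(* An inner vertex has at least three neighbours, but only the terminals and at most one other inner
   vertex are available, so all of these are neighbours. *)
have hub x : x \in inner -> exists x', [/\ x' \in inner, inner :\ x = [set x']
    & neighbours x = [set terminal N; terminal' N; x']].
  rewrite inE => /andP[x_int x_inc].
  have nb_sub : neighbours x \subset [set terminal N; terminal' N] :|: inner :\ x.
    apply/subsetP => y xy; rewrite in_setU in_set2.
    have [y_int | ] := boolP (internal y); last by rewrite negb_and !negbK => ->.
    have yx : y != x by apply: contraTneq xy => ->; apply: neighbours_irrefl.
    rewrite in_setD1 yx [y \in inner]inE y_int orbC /=.
    by rewrite inE adjacentC in xy; rewrite (adjacent_incident xy).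
  have x_inner : x \in inner by rewrite inE x_int.
  have deg_x := leq_trans (irreducible_degree x_int x_inc) (incident_le_neighbours x).
  have card_rest : #|inner :\ x| = 1%N.
    have := card_inner e; rewrite (cardsD1 x) x_inner.
    have := leq_trans deg_x (leq_trans (subset_leq_card nb_sub) (leq_card_setU _ _)).
    by rewrite cards2 aa'; move: #|inner :\ x| => m; lia.
  have [x' rest] : exists x', inner :\ x = [set x'] by apply/cards1P/eqP.
  exists x'; split=> //.
    by have := set11 x'; rewrite -rest => /setD1P[].
  apply/eqP; rewrite eqEcard -{1}rest nb_sub /= (leq_trans _ deg_x) //.
  rewrite rest in nb_sub *; apply: leq_trans (leq_card_setU _ _) _.
  by rewrite cards2 aa' cards1.
have [w' [w'_inner rest nb_w]] := hub w w_inner.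
have [w'' [w''_inner rest' nb_w']] := hub w' w'_inner.
have w'w : w' != w by have := set11 w'; rewrite -rest => /setD1P[].
have w''E : w'' = w.
  have /setD1P[w''w' _] : w'' \in inner :\ w' by rewrite rest' set11.
  apply/eqP; apply: contraT => w''w.
  have : w'' \in inner :\ w by rewrite in_setD1 w''w.
  by rewrite rest inE (negPf w''w').
rewrite {w''}w''E in w''_inner rest' nb_w'.
have edge x y : y \in neighbours x -> exists f, joins f y x.
  by rewrite inE adjacentC => /existsP.
have [eA eA_aw] : exists f, joins f (terminal N) w by apply: edge; rewrite nb_w !inE eqxx.
have [eB eB_aw'] : exists f, joins f (terminal N) w' by apply: edge; rewrite nb_w' !inE eqxx.
have [eC eC_aw] : exists f, joins f (terminal' N) w by apply: edge; rewrite nb_w !inE eqxx orbT.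
have [eD eD_aw'] : exists f, joins f (terminal' N) w' by apply: edge; rewrite nb_w' !inE eqxx orbT.
have [eE eE_ww'] : exists f, joins f w w' by apply: edge; rewrite nb_w' !inE eqxx orbT.
exists w, w', eA, eB, eC, eD, eE; split; rewrite // ?[joins _ _ (terminal' N)]joinsC //.
move: w_inner w'_inner; rewrite !inE => /andP[/andP[wa wa'] _] /andP[/andP[w'a w'a'] _].
by rewrite /= !inE !negb_or ![terminal N == _]eq_sym wa w'a wa' w'a' (eq_sym w w') w'w eq_sym aa'.
Qed.

End Irreducible.

(** * Identification with the bridge and reduction of networks *)

Lemma bridge_edges_uniq (N : configuration) (a a' w w' : vertex N)
    (eA eB eC eD eE : branch N) :
    uniq [:: a; w; w'; a'] -> joins eA a w -> joins eB a w' ->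
    joins eC w a' -> joins eD w' a' -> joins eE w w' ->
  uniq [:: eA; eB; eC; eD; eE].
Proof.
move=> vs jA jB jC jD jE.
have neq (e e' : branch N) x y x' y' : joins e x y -> joins e' x' y' ->
    ~ (x = x' /\ y = y') -> ~ (x = y' /\ y = x') -> e == e' = false.
  move=> exy exy' n1 n2; apply/eqP => ee'; rewrite -ee' in exy'.
  by have [] := joins_eq exy exy'.
move: vs; rewrite /= !inE !negb_or.
move=> /and4P[/and3P[/eqP aw /eqP aw' /eqP aa'] /andP[/eqP ww' /eqP wa'] /eqP w'a' _].
rewrite (neq _ _ _ _ _ _ jA jB) ?(neq _ _ _ _ _ _ jA jC) ?(neq _ _ _ _ _ _ jA jD)
  ?(neq _ _ _ _ _ _ jA jE) ?(neq _ _ _ _ _ _ jB jC) ?(neq _ _ _ _ _ _ jB jD)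
  ?(neq _ _ _ _ _ _ jB jE) ?(neq _ _ _ _ _ _ jC jD) ?(neq _ _ _ _ _ _ jC jE)
  ?(neq _ _ _ _ _ _ jD jE) //; case; congruence.
Qed.

(** This excludes the bridge alternative for a merged network, which has at most four branches. *)
Lemma bridge_shaped_card (N : configuration) : bridge_shaped N -> (5 <= #|branch N|)%N.
Proof.
move=> [w [w' [eA [eB [eC [eD [eE [vs [jA jB] jC jD jE]]]]]]]].
have /card_uniqP es := bridge_edges_uniq vs jA jB jC jD jE.
by rewrite -[5%N]es max_card.
Qed.

Lemma bridge_shaped_realizable (R : realType) (N : configuration) (Z : ratfun R) :
    (#|branch N| <= 5)%N -> bridge_shaped N -> realizable N Z ->
  exists A B C D E, realizable (bridge A B C D E) Z.
Proof.
move=> card5 [w [w' [eA [eB [eC [eD [eE [vs [jA jB] jC jD jE]]]]]]]].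
have es := bridge_edges_uniq vs jA jB jC jD jE.
pose phi := tnth [tuple terminal N; w; w'; terminal' N].
pose psi := tnth [tuple eA; eB; eC; eD; eE].
move=> NZ; exists (kind eA), (kind eB), (kind eC), (kind eD), (kind eE).
apply: (@realizable_transport R N (bridge _ _ _ _ _) phi psi) NZ => //.
- exact/tuple_uniqP.
(* Five distinct branches among at most five exhaust the network. *)
- by apply: inj_card_bij; [apply/tuple_uniqP | rewrite card_ord].
- by apply: bridge_branchP.
- by apply: bridge_branchP.
Qed.

Lemma single_branch_series_parallel (N : configuration) :
  all_on_simple_paths N -> #|branch N| = 1%N -> series_parallel N.
Proof.
move=> [aa' paths] /fintype1[e branch1].
have [/set0Pn[f fa] /set0Pn[f' fa']] := terminals_incident (paths e).
rewrite (branch1 f) in fa; rewrite (branch1 f') in fa'.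
have [x ax] := incidentP _ _ fa; have [x' a'x'] := incidentP _ _ fa'.
rewrite /series_parallel (_ : setT = [set e]); last first.
  by apply/setP => g; rewrite !inE (branch1 g) eqxx.
apply: SpSingle => //.
have [[aE _] | [_ <-//]] := joins_eq ax a'x'.
by rewrite aE eqxx in aa'.
Qed.

Theorem series_parallel_or_bridge (N : configuration) :
    all_on_simple_paths N -> (0 < #|branch N| <= 5)%N ->
  series_parallel N \/ bridge_shaped N.
Proof.
have [n] := ubnP #|branch N|; elim: n N => // n IH N ltn paths /andP[card_gt0 card_le5].
have [aa' path_e] := paths.
have noloop e : src e != tgt e := simple_path_no_loop (path_e e).
(* After one merge at most four branches remain, so the induction hypothesis can only yield a
   series-parallel network. *)
have merge_sp (e1 e2 : branch N) u v : e1 != e2 ->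
    all_on_simple_paths (merge_branches e1 e2 u v) -> series_parallel (merge_branches e1 e2 u v).
  move=> e12 paths_m; have card_m := card_merge e1 e2 u v.
  have card_gt1 : (1 < #|branch N|)%N by apply/card_gt1P; exists e1, e2.
  rewrite -card_m !ltnS in ltn card_gt1 card_le5.
  have [//|//|/bridge_shaped_card] := IH _ ltn paths_m _.
    by rewrite card_gt1 ltnW.
  by rewrite ltnNge card_le5.
have [/existsP[e1 /existsP[e2 /andP[e12 e2j]]] | no_par] :=
    boolP [exists e1 : branch N, exists e2, (e1 != e2) && joins e2 (src e1) (tgt e1)].
  left; apply: series_parallel_merge
    (merge_sp _ _ _ _ e12 (parallel_merge_paths e12 e2j paths)) => //.
    apply: SpParallel; rewrite ?(joins_ends e2j) ?ends1 ?setIid //.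
    - exact: SpSingle (joins_src_tgt e1).
    - exact: SpSingle.
    - by rewrite disjoints1 inE.
  by move=> e _ _; rewrite endsU (joins_ends e2j) ends1 setUid subsetIl.
have no_parallel (e e' : branch N) x y : joins e x y -> joins e' x y -> e = e'.
  move=> exy e'xy; apply/eqP; apply: contraNT no_par => ee'.
  apply/existsP; exists e; apply/existsP; exists e'; rewrite ee' /=.
  by have [[-> ->]|[-> ->]] := joins_eq (joins_src_tgt e) exy; rewrite // joinsC.
have [/existsP[w /andP[w_int /cards2P[e1 [e2 [e12 inc_w]]]]] | no_ser] :=
    boolP [exists w : vertex N, internal w && (#|incident w| == 2%N)].
  have [u e1wu] : exists u, joins e1 w u by apply/incidentP; rewrite inc_w !inE eqxx.
  have [v e2wv] : exists v, joins e2 w v by apply/incidentP; rewrite inc_w !inE eqxx orbT.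
  have e1uw : joins e1 u w by rewrite joinsC.
  (* Equal outer ends would make the two branches parallel, a case already treated. *)
  have uv : u != v.
    apply: contraNneq e12 => uv; rewrite -uv in e2wv.
    by apply/eqP; apply: no_parallel e2wv.
  have joins_neq (e : branch N) x y : joins e x y -> x != y.
    by have := noloop e => + /orP[] /andP[/eqP<- /eqP<-] //; rewrite eq_sym.
  have incw e x : joins e w x -> e = e1 \/ e = e2.
    by move=> /joins_incident; rewrite inc_w => /set2P.
  left; apply: series_parallel_merge
    (merge_sp _ _ _ _ e12 (series_merge_paths e12 w_int e1uw e2wv uv incw paths)) => //.
    apply: SpSeries (SpSingle (joins_neq _ _ _ e1uw) e1uw)
      (SpSingle (joins_neq _ _ _ e2wv) e2wv) _ _.
      by rewrite disjoints1 inE.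
    rewrite (joins_ends e1uw) (joins_ends e2wv); apply/setP => x; rewrite !inE.
    case: (eqVneq x w) => [->|]; rewrite ?orbT // orbF /= => xw.
    by apply/negP => /andP[/eqP -> ]; rewrite (negPf uv).
  move=> e e_e1 e_e2; apply/subsetP => x /setIP[].
  rewrite endsU (joins_ends e1uw) (joins_ends e2wv) ends1 !inE => x_uwv x_e.
  have xw : x != w.
    apply: contraNneq e_e1 => xw; have : e \in incident w.
      by rewrite inE -xw ![_ == x]eq_sym.
    by rewrite inc_w !inE (negPf e_e2) orbF.
  by move: x_uwv; rewrite (negPf xw) orbF /=.
have no_series (w : vertex N) : internal w -> #|incident w| != 2%N.
  by move=> w_int; apply: contraNneq no_ser => w2; apply/existsP; exists w; rewrite w_int w2 eqxx.
have [card1 | card_n1] := eqVneq #|branch N| 1%N.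
  by left; apply: single_branch_series_parallel.
right; apply: irreducible_bridge_shaped => //.
by rewrite ltn_neqAle eq_sym card_n1.
Qed.

(** * Reduced cubic fractions and the characterization *)

Lemma cubicE (R : nzRingType) (c0 c1 c2 c3 : R) :
  c3 *: 'X^3 + c2 *: 'X^2 + c1 *: 'X + c0%:P = Poly [:: c0; c1; c2; c3].
Proof.
apply/polyP => i; rewrite coef_Poly !coefE.
by case: i => [|[|[|[|i]]]]; rewrite /= ?(mulr0, mulr1, addr0, add0r) ?nth_nil.
Qed.

(** Any fraction is a common multiple [h] of a reduced one. As [a] and [d] have the same degree [n],
    so do [p] and [q] by the McMillan degree, which makes [h] constant. *)
Lemma coprime_of_mcmillan (R : realType) (a d : {poly R}) (Z : ratfun R) (n : nat) :
    size a = n.+1 -> size d = n.+1 -> Z = to_ratfun a / to_ratfun d ->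
  mcmillan_degree Z n -> coprimep a d.
Proof.
move=> size_a size_d ZE [p [q [[qn0 co_pq Zpq] deg]]].
have an0 : a != 0 by rewrite -size_poly_gt0 size_a.
have dn0 : d != 0 by rewrite -size_poly_gt0 size_d.
have aq : a * q = d * p.
  apply: to_ratfun_inj; rewrite !to_ratfunM; move: Zpq; rewrite ZE.
  have : to_ratfun q != 0 by rewrite to_ratfun_eq0.
  have : to_ratfun d != 0 by rewrite to_ratfun_eq0.
  move: (to_ratfun a) (to_ratfun d) (to_ratfun p) (to_ratfun q) => u w x y wn0 yn0 e.
  by rewrite -(divfK wn0 u) e [w * x]mulrC mulrAC divfK // mulrC.
have /dvdpP[h aE] : p %| a by rewrite -(Gauss_dvdpl _ co_pq) aq dvdp_mulIr.
have pn0 : p != 0 by apply: contraNneq an0 => p0; rewrite aE p0 mulr0.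
have hn0 : h != 0 by apply: contraNneq an0 => h0; rewrite aE h0 mul0r.
have dE : d = h * q by apply: (mulIf pn0); rewrite -aq aE mulrAC.
have /eqP/size_poly1P[c cn0 hE] : size h = 1%N.
  move: size_a size_d deg; rewrite aE dE !size_mul //.
  move: pn0 qn0 hn0; rewrite -!size_poly_gt0.
  by move: (size h) (size p) (size q) => x y z; lia.
by rewrite aE dE hE !mul_polyC coprimepZl // coprimepZr.
Qed.

Lemma bridge_non_series_parallel_network (R : realType) (Z : ratfun R)
    (A B C D E : element_kind) : realizable (bridge A B C D E) Z ->
  exists N : configuration,
    [/\ is_network N, #|branch N| = 5%N, ~ series_parallel N & realizable N Z].
Proof.
move=> NZ; exists (bridge A B C D E); split=> //; last exact: bridge_not_series_parallel.
  exact: bridge_is_network.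
exact: card_ord.
Qed.

Theorem lemma12 (R : realType) (a0 a1 a2 a3 d0 d1 d2 d3 : R) (Z : ratfun R)
    (ha0 : 0 < a0) (ha1 : 0 < a1) (ha2 : 0 < a2) (ha3 : 0 < a3)
    (hd0 : 0 < d0) (hd1 : 0 < d1) (hd2 : 0 < d2) (hd3 : 0 < d3)
    (hZ : Z = to_ratfun (a3 *: 'X^3 + a2 *: 'X^2 + a1 *: 'X + a0%:P)
            / to_ratfun (d3 *: 'X^3 + d2 *: 'X^2 + d1 *: 'X + d0%:P))
    (hdeg : mcmillan_degree Z 3)
    (hjR : no_pole_zero_imaginary Z) :
  (exists N : configuration,
      [/\ is_network N, #|branch N| = 5%N, ~ series_parallel N
        & realizable N Z])
  <->
  (realizable N7a Z \/ realizable N7b Z \/ realizable N7c Z \/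
   realizable N7d Z \/ realizable N8a Z \/ realizable N8b Z \/
   realizable N9a Z \/ realizable N9b Z \/ realizable N10a Z \/
   realizable N10b Z \/ realizable N11 Z).
Proof.
split=> [[N [[aa' _ paths] card5 not_sp NZ]] | ]; last first.
  do 10![case; first exact: bridge_non_series_parallel_network].
  exact: bridge_non_series_parallel_network.
have card_le5 : (#|branch N| <= 5)%N by rewrite card5.
have [//|shape] : series_parallel N \/ bridge_shaped N.
  by apply: series_parallel_or_bridge; rewrite ?card5.
have [A [B [C [D [E bridgeZ]]]]] := bridge_shaped_realizable card_le5 shape NZ.
rewrite !cubicE in hZ.
have size_cubic (c0 c1 c2 c3 : R) : 0 < c3 -> size (Poly [:: c0; c1; c2; c3]) = 4%N.
  by move=> c3_gt0; rewrite (@PolyK _ 0) //= gt_eqF.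
have size_a := size_cubic a0 a1 a2 a3 ha3; have size_d := size_cubic d0 d1 d2 d3 hd3.
have co_ad := coprime_of_mcmillan size_a size_d hZ hdeg.
have a_0 : (Poly [:: a0; a1; a2; a3])`_0 != 0 by rewrite coef_Poly gt_eqF.
have d_0 : (Poly [:: d0; d1; d2; d3])`_0 != 0 by rewrite coef_Poly gt_eqF.
(* Realizability of [Z] by a labeled bridge is closed under both symmetries, forces balance, and
   fails for the two labelings with a single damper in an arm. *)
apply: (@balanced_labelings (fun A B C D E => realizable (bridge A B C D E) Z)
  _ _ _ _ _ A B C D E bridgeZ) => {A B C D E bridgeZ}.
- by move=> A B C D E; apply: bridge_mirror.
- by move=> A B C D E; apply: bridge_reversed.
- exact (realizable_balanced size_a size_d a_0 d_0 co_ad hZ).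
- exact: (even_arms_unrealizable size_a size_d a_0 d_0 co_ad hZ).
- exact: (even_arms_unrealizable size_a size_d a_0 d_0 co_ad hZ).
Qed.
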